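(* Let $(e_n)$ be a basis of a Banach space $X$. Then the following assertions are equivalent: (a) $(e_n)$ is almost greedy. (b) There exists a constant $C$ such that for any $x\in X$, $m\in\mathbb{N}$, any $A\subset\{1,\dots,\alpha_m(x)-1\}\cup\{\beta_m(x)+1,\dots\}$ with $|A|\le m$, and any $a_i\in\mathbb{R}$, $i\in A$, we have $$\|x-G_m(x)\|\le C\Big\|x-\sum_{i\in A}a_ie_i\Big\|.$$
   Context: Standing setting: $X$ is a real Banach space, possibly finite-dimensional, and $(e_n)$ is a seminormalized Schauder basis of $X$ (i.e. $0<\inf_n\|e_n\|\le\sup_n\|e_n\|<\infty$), with biorthogonal functionals $(e_n^* )$. If $\dim X=N<\infty$, $(e_n)_{n=1}^N$ is an algebraic basis, all indices and index sets lie in $\{1,\dots,N\}$ instead of $\mathbb{N}$, and $m\le N$. $\mathrm{supp}(x)=\{n: e_n^*(x)\ne0\}$; for an index set $A$, $P_A(x)=\sum_{i\in A}e_i^*(x)e_i$ and $|A|$ is its cardinality. Greedy approximation: a greedy ordering for $x\in X$ is an injective map $\rho$ from the index set into itself with $\mathrm{supp}(x)$ contained in the range of $\rho$ and $|e_{\rho(j)}^*(x)|\ge|e_{\rho(k)}^*(x)|$ whenever $j<k$. Put $\Lambda_m(x)=\{\rho(1),\dots,\rho(m)\}$, $G_m(x)=\sum_{n\in\Lambda_m(x)}e_n^*(x)e_n$, $\alpha_m(x)=\min\Lambda_m(x)$, $\beta_m(x)=\max\Lambda_m(x)$. Statements involving $G_m(x)$, $\Lambda_m(x)$, $\alpha_m(x)$,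 $\beta_m(x)$ are meant for any greedy ordering of $x$ (the same ordering throughout the statement). Definition: $(e_n)$ is almost greedy if there is $C$ with $\|x-G_m(x)\|\le C\inf\{\|x-P_A(x)\| : |A|\le m\}$ for all $x\in X$, $m\in\mathbb{N}$. *)

(* Defs.v *)
From mathcomp Require Import all_boot all_order all_algebra finmap.
From mathcomp Require Import all_classical all_reals all_analysis.

Set Implicit Arguments.
Unset Strict Implicit.
Unset Printing Implicit Defensive.

Import Order.TTheory GRing.Theory Num.Theory.
Import numFieldNormedType.Exports.

Local Open Scope classical_set_scope.
Local Open Scope ring_scope.

(* Indices are 0-based.  A basis is a map e : nat -> X together with
   N : option nat.  For N = None the index set is all of nat; for N = Some d
   it is {0, .., d - 1}, and the values of e outside of it play no role. *)
Definition idx (N : option nat) (n : nat) : bool :=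
  if N is Some d then (n < d)%N else true.

(* The lengths m >= 1 of greedy sums, with m <= dim X in the
   finite-dimensional case. *)
Definition admissible (N : option nat) (m : nat) : bool :=
  (0 < m)%N && (if N is Some d then (m <= d)%N else true).

Section Basis.
Context {R : realType} {X : completeNormedModType R}.
Variables (N : option nat) (e : nat -> X).

(* Setting a to 0 outside of the index set is only a normalization; it makes
   the coefficient sequence unique as a function on nat. *)
Definition expansion (x : X) (a : nat -> R) : Prop :=
  (forall n, ~~ idx N n -> a n = 0) /\
  (if N is Some d then x = \sum_(0 <= n < d) a n *: e n
   else series (fun n => a n *: e n) @ \oo --> x).

Definition schauder_basis : Prop :=
  forall x : X, exists! a : nat -> R, expansion x a.

Definition seminormalized : Prop :=
  (0 < ereal_inf [set `|e n|%:E | n in [set n | idx N n]])%E /\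
  (ereal_sup [set `|e n|%:E | n in [set n | idx N n]] < +oo)%E.

(* The biorthogonal functionals e_n^*, as the coefficient functionals of the
   basis.  The default value 0 is not used when schauder_basis holds. *)
Definition coef (n : nat) (x : X) : R :=
  xget (fun=> 0) [set a | expansion x a] n.

Definition proj (A : {fset nat}) (x : X) : X :=
  \sum_(i <- A) coef i x *: e i.

Definition greedy_ordering (x : X) (rho : nat -> nat) : Prop :=
  [/\ forall j, idx N j -> idx N (rho j),
      forall j k, idx N j -> idx N k -> rho j = rho k -> j = k,
      forall n, idx N n -> coef n x != 0 -> exists2 j, idx N j & rho j = n
    & forall j k, idx N j -> idx N k -> (j < k)%N ->
        `|coef (rho k) x| <= `|coef (rho j) x|].

Definition greedy_set (rho : nat -> nat) (m : nat) : {fset nat} :=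
  [fset rho j | j in iota 0 m]%fset.

Definition greedy_sum (rho : nat -> nat) (m : nat) (x : X) : X :=
  proj (greedy_set rho m) x.

(* For m > 0 the default rho 0 belongs to greedy_set rho m. *)
Definition alpha (rho : nat -> nat) (m : nat) : nat :=
  \big[minn/rho 0%N]_(i <- greedy_set rho m) i.

Definition beta (rho : nat -> nat) (m : nat) : nat :=
  \max_(i <- greedy_set rho m) i.

Definition almost_greedy : Prop :=
  exists C : R, forall (x : X) (rho : nat -> nat) (m : nat),
    greedy_ordering x rho -> admissible N m ->
    `|x - greedy_sum rho m x| <=
      C * inf [set `|x - proj A x| | A in
                [set A : {fset nat} | (forall i, i \in A -> idx N i) /\
                                      (#|` A| <= m)%N]].

End Basis.

(* Main.v *)
(* Both assertions contain the estimate |x - G_m x| <= C |x - P_A x| for sets A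
   lying entirely to the left or entirely to the right of Lambda_m(x), and this
   estimate gives back both.  With A empty it says that the basis is
   quasi-greedy.  Applied to finitely supported vectors it compares
   |sum_E a_i e_i| with |sum_D b_i e_i| when |E| <= |D| and
   max |a| <= t <= min |b|: through a far away third set if dim X is infinite,
   and by boundedness of the coefficients, a consequence of quasi-greediness,
   otherwise.
   Now let B = Lambda_m(x), t = min_B |e_n^*(x)|, let A be any set disjoint from
   B with |A| <= |B|, and y = x - sum_A a_i e_i.  Then
   G = B + {i in A : |e_i^*(y)| > t} is a greedy set of y, and
   x - P_B x = (y - P_G y) + P_A x - P_(A \ G) y, where the first term is bounded
   by quasi-greediness and the two others by a multiple of |P_G y|.  Assertion
   (b) is a special case of this, and (a) follows after removing the part of x
   supported on the intersection of A and B. *)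
Require Import Defs.
From mathcomp Require Import all_boot all_order all_algebra finmap.
From mathcomp Require Import all_classical all_reals all_analysis.

Set Implicit Arguments.
Unset Strict Implicit.
Unset Printing Implicit Defensive.

Import Order.TTheory GRing.Theory Num.Theory.
Import numFieldNormedType.Exports.

Local Open Scope classical_set_scope.
Local Open Scope ring_scope.

(** * Index sets and enumeration by decreasing weight *)

Lemma idx_leq (N : option nat) (i j : nat) : (i <= j)%N -> idx N j -> idx N i.
Proof. by case: N => [d|] //=; exact: leq_ltn_trans. Qed.

Lemma ltn_card_idx (N : option nat) (B : {fset nat}) (j : nat) :
  (forall i, i \in B -> idx N i) -> (j < #|` B|)%N -> idx N j.
Proof.
case: N => [d|] //= Bd jB; apply: leq_trans jB _.
rewrite -[leqRHS](size_iota 0); apply: uniq_leq_size => [|i /Bd].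
  exact: fset_uniq.
by rewrite mem_iota.
Qed.

Lemma admissible_card (N : option nat) (B : {fset nat}) :
  B != fset0 -> (forall i, i \in B -> idx N i) -> admissible N #|` B|.
Proof.
rewrite -cardfs_gt0 /admissible => B0 Bidx; rewrite B0.
case: N Bidx => [d|] //= Bidx; move: (B0) => /prednK <-.
by apply: (@ltn_card_idx (Some d) B) => //; rewrite prednK.
Qed.

Section DecreasingEnumeration.
Context {R : realType} (N : option nat) (k : nat -> R).
Hypothesis k_ge0 : forall n, 0 <= k n.
(** For infinitely many indices this says that [k] tends to 0. The first conjunct keeps [M] within
    the index set; a basis of [d] vectors satisfies both conjuncts with [M = d]. *)
Hypothesis k_vanishes : forall eps, 0 < eps -> exists M,
  (forall j, (j < M)%N -> idx N j) /\
  (forall n, idx N n -> eps <= k n -> (n < M)%N).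

Definition maximal_outside (s : seq nat) (n : nat) : Prop :=
  [/\ idx N n, n \notin s &
      forall i, idx N i -> i \notin s -> k i <= k n].

(** If some index outside [s] has positive weight, only finitely many have at least that weight, and
    a maximum is attained among them. Otherwise all weights outside [s] vanish and any index there
    will do. *)
Lemma maximal_outside_exists (s : seq nat) :
  idx N (size s) -> exists n, maximal_outside s n.
Proof.
move=> Ns.
have [n0 n0N n0s] : exists2 n, idx N n & n \notin s.
  (* Pigeonhole: otherwise the indices 0, .., [size s] would all lie in [s]. *)
  apply: contrapT => H; suff: (size (iota 0 (size s).+1) <= size s)%N.
    by rewrite size_iota ltnn.
  apply: uniq_leq_size => [|i]; first exact: iota_uniq.
  rewrite mem_iota add0n ltnS => /idx_leq/(_ Ns) iN; apply: contrapT => /negP si.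
  by apply: H; exists i.
have [[n [nN ns kn]]|H] := pselect (exists n, [/\ idx N n, n \notin s & 0 < k n]).
  have [M [MN nM]] := k_vanishes kn.
  have nltM := nM n nN (lexx _).
  pose P := [pred i : 'I_M | val i \notin s].
  have Pn : P (Ordinal nltM) by [].
  case: (arg_maxP (fun i : 'I_M => k i) Pn) => j /= js jmax.
  exists j; split=> // [|i iN si]; first exact: MN.
  have [kin|/ltW kni] := leP (k n) (k i).
    exact: (jmax (Ordinal (nM _ iN kin)) si).
  exact: le_trans kni (jmax (Ordinal nltM) ns).
exists n0; split=> // i iN si; apply: le_trans (k_ge0 _).
by rewrite leNgt; apply/negP => ki; apply: H; exists i.
Qed.

Fixpoint greedy_prefix (j : nat) : seq nat :=
  if j is i.+1 then
    rcons (greedy_prefix i) (xget 0%N [set n | maximal_outside (greedy_prefix i) n])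
  else [::].

Lemma decreasing_enumeration : exists rho : nat -> nat,
  forall j, idx N j -> maximal_outside (mkseq rho j) (rho j).
Proof.
pose rho j := xget 0%N [set n | maximal_outside (greedy_prefix j) n].
exists rho => j jN.
have -> : mkseq rho j = greedy_prefix j.
  by elim: j {jN} => // j IH; rewrite mkseqS IH.
apply: xgetPex; apply: maximal_outside_exists.
suff -> : size (greedy_prefix j) = j by [].
by elim: j {jN} => //= j IH; rewrite size_rcons IH.
Qed.

Section Consequences.
Variable rho : nat -> nat.
Hypothesis rhoP : forall j, idx N j -> maximal_outside (mkseq rho j) (rho j).

Lemma mem_mkseq_lt (i j : nat) : (i < j)%N -> rho i \in mkseq rho j.
Proof. by move=> ij; apply/mapP; exists i; rewrite // mem_iota. Qed.

Lemma enumeration_neq (i j : nat) : idx N j -> (i < j)%N -> rho i != rho j.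
Proof.
move=> jN ij; have [_ /negP rj _] := rhoP jN.
by apply/eqP => rij; apply: rj; rewrite -rij mem_mkseq_lt.
Qed.

Lemma enumeration_inj (i j : nat) :
  idx N i -> idx N j -> rho i = rho j -> i = j.
Proof.
move=> iN jN rij; case: (ltngtP i j) => // [ij|ji].
  by move: (enumeration_neq jN ij); rewrite rij eqxx.
by move: (enumeration_neq iN ji); rewrite rij eqxx.
Qed.

Lemma enumeration_uniq (m : nat) :
  (forall j, (j < m)%N -> idx N j) -> uniq (mkseq rho m).
Proof.
move=> mN; rewrite map_inj_in_uniq ?iota_uniq // => i j.
by rewrite !mem_iota !add0n => im jm; apply: enumeration_inj; apply: mN.
Qed.

Lemma enumeration_decreasing (i j : nat) :
  idx N j -> (i < j)%N -> k (rho j) <= k (rho i).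
Proof.
move=> jN ij; have [_ _ kmax] := rhoP (idx_leq (ltnW ij) jN).
have [rjN rj _] := rhoP jN; apply: kmax => //; apply: contra rj.
case/mapP => l; rewrite mem_iota add0n => li ->.
exact/mem_mkseq_lt/ltn_trans/ij.
Qed.

(** If [n] is not among the first [M] values, each of these was preferred to it and so weighs at
    least [k n]. Together with [n] they would be [M + 1] distinct numbers below [M]. *)
Lemma enumeration_exhausts (n : nat) :
  idx N n -> 0 < k n -> exists2 j, idx N j & rho j = n.
Proof.
move=> nN kn; have [M [MN kM]] := k_vanishes kn.
have [/mapP[j]|nrho] := boolP (n \in mkseq rho M).
  by rewrite mem_iota add0n => /MN jN ->; exists j.
suff : (size (n :: mkseq rho M) <= size (iota 0 M))%N.
  by rewrite /= size_mkseq size_iota ltnn.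
apply: uniq_leq_size => [|i]; first by rewrite /= nrho enumeration_uniq.
rewrite mem_iota add0n inE => /predU1P[->|/mapP[j]]; first exact: kM.
rewrite mem_iota add0n => jM ->.
have [rjN _ kmax] := rhoP (MN _ jM); apply: kM => //; apply: kmax => //.
apply: contra nrho => /mapP[l]; rewrite mem_iota add0n => lj ->.
exact/mem_mkseq_lt/ltn_trans/jM.
Qed.

(** As long as fewer than [#|B|] values are chosen, some element of [B] is still available and
    outweighs everything outside [B]. So the first [#|B|] values lie in [B], and by injectivity they
    exhaust it. *)
Lemma enumeration_initial (B : {fset nat}) :
  (forall i, i \in B -> idx N i) ->
  (forall i j, i \in B -> idx N j -> j \notin B -> k j < k i) ->
  greedy_set rho #|` B| = B.
Proof.
move=> BN kB.
have NB j : (j < #|` B|)%N -> idx N j by exact: ltn_card_idx.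
have rB j : (j < #|` B|)%N -> rho j \in B.
  move=> jB; have [rjN _ kmax] := rhoP (NB _ jB).
  have [n nB nr] : exists2 n, n \in B & n \notin mkseq rho j.
    apply: contrapT => H; suff: (#|` B| <= size (mkseq rho j))%N.
      by rewrite size_mkseq leqNgt jB.
    apply: uniq_leq_size => [|i iB]; first exact: fset_uniq.
    by apply: contrapT => /negP ir; apply: H; exists i.
  apply: contrapT => /negP rjB; have := kB _ _ nB rjN rjB.
  by rewrite ltNge kmax // BN.
apply/eqP; rewrite eqEfcard; apply/andP; split.
  apply/fsubsetP => i /imfsetP[j /=]; rewrite mem_iota add0n => jB ->.
  exact: rB.
rewrite card_in_imfset /= => [|i j].
  by rewrite undup_id ?iota_uniq // size_iota.
by rewrite !mem_iota !add0n => iB jB; apply: enumeration_inj; apply: NB.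
Qed.

End Consequences.
End DecreasingEnumeration.

(** * Coefficient functionals and greedy sets *)

Section Coefficients.
Context {R : realType} {X : completeNormedModType R}.
Variables (N : option nat) (e : nat -> X).
Hypothesis e_basis : schauder_basis N e.
Implicit Types (x y : X) (A B : {fset nat}).

Lemma coef_expansion x : expansion N e x (fun n => coef N e n x).
Proof.
apply: (@xgetPex _ (fun=> 0) [set a | expansion N e x a]).
by have [a [ha _]] := e_basis x; exists a.
Qed.

Lemma expansion_coef x a n : expansion N e x a -> coef N e n x = a n.
Proof.
move=> xa; have [b [_ b_unique]] := e_basis x.
by rewrite -(b_unique _ xa) (b_unique _ (coef_expansion x)).
Qed.

Lemma expansionD x y a b : expansion N e x a -> expansion N e y b ->
  expansion N e (x + y) (fun n => a n + b n).
Proof.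
move=> [a0 xa] [b0 yb]; split=> [n nN|].
  by rewrite a0 // b0 // addr0.
have sumE m : \sum_(0 <= n < m) (a n + b n) *: e n =
    \sum_(0 <= n < m) a n *: e n + \sum_(0 <= n < m) b n *: e n.
  by rewrite -big_split; apply: eq_bigr => n _; rewrite scalerDl.
case: N xa yb {a0 b0} => [d -> ->|xa yb]; first by rewrite sumE.
have -> : series (fun n => (a n + b n) *: e n) =
    series (fun n => a n *: e n) + series (fun n => b n *: e n).
  by apply/funext => m; rewrite /series /= sumE.
exact: cvgD.
Qed.

Lemma expansionZ x a t : expansion N e x a ->
  expansion N e (t *: x) (fun n => t * a n).
Proof.
move=> [a0 xa]; split=> [n nN|]; first by rewrite a0 // mulr0.
have sumE m : \sum_(0 <= n < m) (t * a n) *: e n =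
    t *: \sum_(0 <= n < m) a n *: e n.
  by rewrite scaler_sumr; apply: eq_bigr => n _; rewrite scalerA.
case: N xa {a0} => [d ->|xa]; first by rewrite sumE.
have -> : series (fun n => (t * a n) *: e n) =
    t \*: series (fun n => a n *: e n).
  by apply/funext => m; rewrite /series /= sumE.
exact: cvgZl_tmp.
Qed.

Lemma expansion_basis i : idx N i -> expansion N e (e i) (fun n => (n == i)%:R).
Proof.
move=> iN; split=> [n|]; first by have [->|//] := eqVneq n i; rewrite iN.
have sumE m : (i < m)%N -> \sum_(0 <= n < m) (n == i)%:R *: e n = e i.
  move=> im; rewrite big_mkord (bigD1 (Ordinal im)) //= eqxx scale1r.
  rewrite big1 ?addr0 // => n ni.
  by rewrite (negbTE (_ : (n : nat) != i)) ?scale0r.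
case: N iN => [d /sumE -> //|_].
apply: cvg_near_cst; exists i.+1 => // m /= im; exact: sumE.
Qed.

Lemma coefD n x y : coef N e n (x + y) = coef N e n x + coef N e n y.
Proof.
exact: (expansion_coef n (expansionD (coef_expansion x) (coef_expansion y))).
Qed.

Lemma coefZ n t x : coef N e n (t *: x) = t * coef N e n x.
Proof. exact: (expansion_coef n (expansionZ t (coef_expansion x))). Qed.

Lemma coefB n x y : coef N e n (x - y) = coef N e n x - coef N e n y.
Proof. by rewrite -scaleN1r coefD coefZ mulN1r. Qed.

Lemma coef0 n : coef N e n 0 = 0.
Proof. by rewrite -(scale0r 0) coefZ mul0r. Qed.

Lemma coef_sum n A (a : nat -> R) : (forall i, i \in A -> idx N i) ->
  coef N e n (\sum_(i <- A) a i *: e i) = if n \in A then a n else 0.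
Proof.
move=> AN.
rewrite (big_morph (coef N e n) (coefD n) (coef0 n)) /=.
rewrite big_seq (eq_bigr (fun i => a i * (n == i)%:R)) => [|i /AN iN].
  rewrite -big_seq; have [nA|nA] := boolP (n \in A).
    rewrite (big_fsetD1 n) //= eqxx mulr1 big_seq big1 ?addr0 // => i.
    by rewrite !inE eq_sym => /andP[/negbTE -> _]; rewrite mulr0.
  rewrite big_seq big1 // => i iA.
  by have [ni|] := eqVneq n i; rewrite ?mulr0 //; rewrite ni iA in nA.
by rewrite coefZ (expansion_coef n (expansion_basis iN)).
Qed.

Lemma coef_proj n A x : (forall i, i \in A -> idx N i) ->
  coef N e n (Defs.proj N e A x) = if n \in A then coef N e n x else 0.
Proof. exact: (coef_sum n (fun i => coef N e i x)). Qed.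

Lemma sum_fsetU A B (a : nat -> R) : [disjoint A & B]%fset ->
  \sum_(i <- (A `|` B)%fset) a i *: e i =
  \sum_(i <- A) a i *: e i + \sum_(i <- B) a i *: e i.
Proof.
move=> dAB; rewrite (big_fsetID _ (mem A)) /=; congr (_ + _).
  by apply: eq_fbigl => i; rewrite !inE andb_idl ?orbT // => ->.
apply: eq_fbigl => i; rewrite !inE /=.
have [iA|] //= := boolP (i \in A); rewrite ?andbT ?andbF //.
by apply/esym/negbTE; apply: (fdisjointP dAB).
Qed.

Variable c : R.
Hypothesis c_gt0 : 0 < c.
Hypothesis c_le : forall n, idx N n -> c <= `|e n|.

(** In the infinite case the terms of a convergent series tend to 0, and the lower bound [c] on the
    norms passes this on to the coefficients. *)
Lemma coef_vanishes x eps : 0 < eps -> exists M,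
  (forall j, (j < M)%N -> idx N j) /\
  (forall n, idx N n -> eps <= `|coef N e n x| -> (n < M)%N).
Proof.
move=> eps0; have := coef_expansion x; case: N c_le => [d|] /= c_le' [_ xa].
  by exists d.
have /cvgr0Pnorm_lt : (fun n => coef None e n x *: e n) @ \oo --> 0.
  by apply: cvg_series_cvg_0; apply/cvg_ex; exists x.
move=> /(_ _ (mulr_gt0 eps0 c_gt0)) [M _ HM]; exists M; split=> // n _ epsn.
rewrite ltnNge; apply/negP => /HM /=; rewrite normrZ ltNge => /negP; apply.
by rewrite ler_pM ?(ltW eps0) ?(ltW c_gt0) ?c_le'.
Qed.

(** Greedy sets without reference to an ordering: the two lemmas below translate between these sets
    and the initial segments of greedy orderings. *)
Definition is_greedy_set x B : Prop :=
  (forall i, i \in B -> idx N i) /\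
  (forall i j, i \in B -> idx N j -> j \notin B ->
     `|coef N e j x| <= `|coef N e i x|).

(* Adding 1 to the weights on B resolves the ties in favour of B. *)
Lemma greedy_ordering_exists x B : is_greedy_set x B ->
  exists2 rho, greedy_ordering N e x rho & greedy_set rho #|` B| = B.
Proof.
move=> [BN Bx]; pose k n := `|coef N e n x| + (n \in B)%:R.
have k_ge0 n : 0 <= k n by rewrite addr_ge0.
have kB i j : i \in B -> idx N j -> j \notin B -> k j < k i.
  by move=> iB jN jB; rewrite /k iB (negbTE jB) addr0 ltr_pwDr // Bx.
have k_vanishes eps : 0 < eps -> exists M,
    (forall j, (j < M)%N -> idx N j) /\
    (forall n, idx N n -> eps <= k n -> (n < M)%N).
  move=> eps0; have [M [MN xM]] := coef_vanishes x eps0.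
  (* Elements of [B] have weight at least 1 however small their coefficients, so the bound has to
     cover [B] as well. *)
  pose M' := maxn M (\max_(i <- B) i.+1).
  exists M'; split=> [j|n nN]; rewrite /M' leq_max.
    case/orP=> [/MN //|]; apply: contraTT => jN.
    rewrite -leqNgt; apply/bigmax_leqP_seq => i /BN iN _; rewrite ltnNge.
    by apply: contra jN => /idx_leq; apply.
  rewrite /k; have [nB _|_] := boolP (n \in B).
    by rewrite (@leq_bigmax_seq _ _ _ succn n) ?orbT.
  by rewrite addr0 => /(xM _ nN) ->.
have [rho rhoP] := decreasing_enumeration k_ge0 k_vanishes.
exists rho; last exact: (enumeration_initial rhoP).
split=> [j /rhoP[] //|j l|n nN n0|j l jN lN jl].
- exact: (enumeration_inj rhoP).
- apply: (enumeration_exhausts k_vanishes rhoP) => //.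
  by rewrite ltr_wpDr // normr_gt0.
- have := enumeration_decreasing rhoP lN jl; rewrite /k.
  have [rlB|rlB] := boolP (rho l \in B); have [rjB|rjB] := boolP (rho j \in B).
  + by rewrite lerD2r.
  (* An impossible case: the extra weight would have put [rho l] before [rho j]. *)
  + have [rjN _ _] := rhoP _ jN; rewrite addr0 => klj.
    have := Bx _ _ rlB rjN rjB; rewrite leNgt => /negP[].
    by apply: lt_le_trans klj; rewrite ltrDl.
  + by have [rlN _ _] := rhoP _ lN; move=> _; exact: Bx.
  + by rewrite !addr0.
Qed.

Lemma greedy_setP x rho m : greedy_ordering N e x rho -> admissible N m ->
  is_greedy_set x (greedy_set rho m) /\ #|` greedy_set rho m| = m.
Proof.
move=> [rhoN rho_inj rho_supp rho_dec] mN.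
have NM j : (j < m)%N -> idx N j.
  case: N mN => [d|] //= /andP[_ md] jm; exact: leq_trans jm md.
split; last first.
  rewrite card_in_imfset /= => [|i j].
    by rewrite undup_id ?iota_uniq // size_iota.
  by rewrite !mem_iota !add0n => im jm; apply: rho_inj; apply: NM.
split=> [i /imfsetP[j /=]|_ n /imfsetP[i /= im ->] nN nm].
  by rewrite mem_iota add0n => /NM/rhoN jN ->.
rewrite mem_iota add0n in im.
(* A greedy ordering need not reach an index with zero coefficient, but there the inequality is
   trivial. *)
have [->|/(rho_supp _ nN)[j jN rjn]] := eqVneq (coef N e n x) 0.
  by rewrite normr0.
rewrite -rjn; apply: rho_dec => //; first exact: NM.
apply: leq_trans im _; rewrite leqNgt; apply: contra nm => jm.
by apply/imfsetP; exists j; rewrite //= mem_iota.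
Qed.

End Coefficients.

(** * From separated sets to arbitrary disjoint sets *)

Lemma fset_min_exists (R : realType) (B : {fset nat}) (f : nat -> R) : B != fset0 ->
  exists2 i, i \in B & forall j, j \in B -> f i <= f j.
Proof.
case/fset0Pn => i0 i0B.
case: (arg_minP (fun i : B => f (val i)) (isT : predT [` i0B]%fset)) => i _ imin.
by exists (val i) => [|j jB]; [exact: valP | exact: (imin [` jB]%fset)].
Qed.

Section GreedyBounds.
Context {R : realType} {X : completeNormedModType R}.
Variables (N : option nat) (e : nat -> X).
Hypothesis e_basis : schauder_basis N e.
Variable c : R.
Hypothesis c_gt0 : 0 < c.
Hypothesis c_le : forall n, idx N n -> c <= `|e n|.
Implicit Types (x y : X) (A B D E : {fset nat}) (a b : nat -> R).

Definition separated A B : Prop :=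
  (forall i j, i \in A -> j \in B -> (i < j)%N) \/
  (forall i j, i \in A -> j \in B -> (j < i)%N).

Lemma separated_disjoint A B : separated A B -> [disjoint A & B]%fset.
Proof.
move=> sAB; apply/fdisjointP => i iA; apply/negP => iB.
by case: sAB => /(_ i i iA iB); rewrite ltnn.
Qed.

(** Only projections occur here, as in (a); the free coefficients of (b) are regained in
    [disjoint_greedy_bound]. *)
Definition separated_greedy_bound (C : R) : Prop :=
  forall x B A, is_greedy_set N e x B -> (forall i, i \in A -> idx N i) ->
    separated A B -> (#|` A| <= #|` B|)%N ->
    `|x - Defs.proj N e B x| <= C * `|x - Defs.proj N e A x|.

(** With all coefficients equal to 1 this is democracy of the basis. [E] and [D] may overlap. *)
Definition largest_coef_bound (K : R) : Prop :=
  forall E D a b t, (forall i, i \in E -> idx N i) ->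
    (forall i, i \in D -> idx N i) -> (#|` E| <= #|` D|)%N -> 0 <= t ->
    (forall i, i \in E -> `|a i| <= t) -> (forall i, i \in D -> t <= `|b i|) ->
    `|\sum_(i <- E) a i *: e i| <= K * `|\sum_(i <- D) b i *: e i|.

Lemma proj_fset0 x : Defs.proj N e fset0 x = 0.
Proof. by rewrite /Defs.proj big_seq_fset0. Qed.

Lemma eq_proj_sum A x a : (forall i, i \in A -> coef N e i x = a i) ->
  Defs.proj N e A x = \sum_(i <- A) a i *: e i.
Proof.
by move=> xa; rewrite /Defs.proj big_seq [RHS]big_seq; apply: eq_bigr => i /xa ->.
Qed.

Section SeparatedToLargest.
Variable C : R.
Hypothesis C_ge1 : 1 <= C.
Hypothesis sepC : separated_greedy_bound C.

Let C_ge0 : 0 <= C := le_trans ler01 C_ge1.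

Lemma quasi_greedy_bound x B : is_greedy_set N e x B ->
  `|x - Defs.proj N e B x| <= C * `|x|.
Proof.
move=> xB; have := @sepC x B fset0 xB; rewrite proj_fset0 subr0; apply=> //.
by left.
Qed.

Lemma greedy_proj_bound x B : is_greedy_set N e x B ->
  `|Defs.proj N e B x| <= (1 + C) * `|x|.
Proof.
move=> /quasi_greedy_bound; rewrite mulrDl mul1r => xB.
rewrite -[Defs.proj _ _ _ _](subKr x); apply: le_trans (ler_normB _ _) _.
by rewrite lerD2l.
Qed.

(** A greedy set with one element [n] carries a largest coefficient, and its greedy sum has norm at
    least [c] times that coefficient. *)
Lemma coef_bound x j : idx N j -> `|coef N e j x| * c <= (1 + C) * `|x|.
Proof.
(* The empty set serves only to obtain some greedy ordering of [x]. *)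
move=> jN; have x0 : is_greedy_set N e x fset0 by split.
have [rho xrho _] := greedy_ordering_exists e_basis c_gt0 c_le x0.
have N1 : admissible N 1 by case: N jN => // d; apply: leq_ltn_trans.
have [xB /eqP/cardfs1P[n Bn]] := greedy_setP xrho N1.
rewrite Bn in xB; have [BN Bmax] := xB.
have nN : idx N n by apply: BN; rewrite inE.
apply: le_trans (greedy_proj_bound xB).
rewrite /Defs.proj big_seq_fset1 normrZ ler_pM ?(ltW c_gt0) ?c_le //.
have [->//|jn] := eqVneq j n.
by apply: Bmax; rewrite ?inE.
Qed.

(** [D] is a greedy set of the sum [z] of both vectors; removing [D] from [z] leaves the sum over
    [E], and removing [E] leaves the sum over [D]. *)
Lemma separated_coef_bound E D a b t : (forall i, i \in E -> idx N i) ->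
  (forall i, i \in D -> idx N i) -> (#|` E| <= #|` D|)%N -> separated E D ->
  (forall i, i \in E -> `|a i| <= t) -> (forall i, i \in D -> t <= `|b i|) ->
  `|\sum_(i <- E) a i *: e i| <= C * `|\sum_(i <- D) b i *: e i|.
Proof.
move=> EN DN ED sED Et Dt.
have dED := separated_disjoint sED.
pose z := \sum_(i <- E) a i *: e i + \sum_(i <- D) b i *: e i.
have zE n : coef N e n z =
    (if n \in E then a n else 0) + (if n \in D then b n else 0).
  by rewrite coefD // !coef_sum.
have zD : Defs.proj N e D z = \sum_(i <- D) b i *: e i.
  apply: eq_proj_sum => i iD; rewrite zE iD ifN ?add0r //.
  by apply: (fdisjointP _ i iD); rewrite fdisjoint_sym.
have zE' : Defs.proj N e E z = \sum_(i <- E) a i *: e i.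
  apply: eq_proj_sum => i iE; rewrite zE iE ifN ?addr0 //.
  exact: (fdisjointP dED).
have := @sepC z D E; rewrite zD zE' /z addrK [X in C * `|X|]addrAC subrr add0r.
apply=> //; split=> // i j iD jN jD; rewrite !zE iD (negbTE jD) addr0.
rewrite [in leRHS]ifN ?add0r; last first.
  by apply: (fdisjointP _ i iD); rewrite fdisjoint_sym.
by case: ifPn => [/Et jt|_]; rewrite ?normr0 // (le_trans jt) ?Dt.
Qed.

Lemma largest_coef_bound_exists : exists2 K, 0 <= K & largest_coef_bound K.
Proof.
case N_eq : N => [d|].
  (* In finite dimension there may be no room for a third set. Instead, the sum over [E] is at most
     [S * t], and [t] is at most any one coefficient over [D], which [coef_bound] controls. *)
  pose S := \sum_(i <- iota 0 d) `|e i|.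
  have S_ge0 : 0 <= S by apply: sumr_ge0.
  exists (S * ((1 + C) / c)) => [|E D a b t EN DN ED t0 Et Dt].
    by rewrite mulr_ge0 // divr_ge0 ?(ltW c_gt0) // addr_ge0.
  have [D0|/fset0Pn[j jD]] := eqVneq D fset0.
    move: ED; rewrite D0 cardfs0 leqn0 cardfs_eq0 => /eqP ->.
    by rewrite !big_seq_fset0 normr0 mulr0.
  have tS : `|\sum_(i <- E) a i *: e i| <= S * t.
    apply: le_trans (ler_norm_sum _ _ _) _.
    apply: (@le_trans _ _ (\sum_(i <- E) `|e i| * t)).
      rewrite big_seq [leRHS]big_seq; apply: ler_sum => i iE.
      by rewrite normrZ mulrC ler_wpM2l // Et.
    rewrite -mulr_suml ler_wpM2r //.
    rewrite (perm_big [seq i <- iota 0 d | i \in E]) /=; last first.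
      apply: uniq_perm; rewrite ?fset_uniq ?filter_uniq ?iota_uniq // => i.
      rewrite mem_filter mem_iota add0n andb_idr // => /EN.
      by rewrite N_eq.
    by rewrite big_filter big_mkcond; apply: ler_sum => i _; case: ifP.
  apply: le_trans tS _; rewrite -mulrA ler_wpM2l // mulrAC ler_pdivlMr //.
  apply: le_trans (coef_bound _ (DN _ jD)).
  by rewrite coef_sum // jD ler_wpM2r ?(ltW c_gt0) // Dt.
exists (C * C) => [|E D a b t _ _ ED t0 Et Dt]; first exact: mulr_ge0.
pose M := (\max_(i <- (E `|` D)%fset) i.+1)%N.
have ltM i : (i \in E) || (i \in D) -> (i < M)%N.
  by move=> iED; apply: (@leq_bigmax_seq _ _ _ succn i); rewrite // inE.
(* [F] has as many elements as [D] and lies to the right of both [E] and [D]. Comparing [E] with [F]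
   and [F] with [D] costs a factor [C] each. *)
pose F := [fset j in iota M #|` D|]%fset.
have leF j : j \in F -> (M <= j)%N by rewrite !inE /= mem_iota => /andP[].
have cardF : #|` F| = #|` D|.
  by rewrite card_fseq undup_id ?iota_uniq // size_iota.
apply: (@le_trans _ _ (C * `|\sum_(i <- F) t *: e i|)).
  apply: (@separated_coef_bound _ _ _ (fun=> t) t) => //; rewrite ?N_eq ?cardF //.
    left=> i j iE /leF; apply: leq_trans; exact/ltM/orP/or_introl.
  by move=> i _; rewrite ger0_norm.
rewrite -mulrA ler_wpM2l //.
apply: (@separated_coef_bound _ _ (fun=> t) _ t) => //; rewrite ?N_eq ?cardF //.
  right=> i j /leF iM jD; apply: leq_trans iM; exact/ltM/orP/or_intror.
by move=> i _; rewrite ger0_norm.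
Qed.

Lemma disjoint_greedy_bound : exists2 C', 1 <= C' &
  forall x B A a, is_greedy_set N e x B -> (forall i, i \in A -> idx N i) ->
    [disjoint A & B]%fset -> (#|` A| <= #|` B|)%N ->
    `|x - Defs.proj N e B x| <= C' * `|x - \sum_(i <- A) a i *: e i|.
Proof.
have [K K0 boundK] := largest_coef_bound_exists.
have KC0 : 0 <= K * (1 + C) by rewrite mulr_ge0 // addr_ge0.
have C'1 : 1 <= C + (K * (1 + C) + K * (1 + C)).
  by rewrite (le_trans C_ge1) // lerDl addr_ge0.
(* [C] accounts for [y - P_G y], and each [K * (1 + C)] for one of [P_A x] and [P_A2 y]. *)
exists (C + (K * (1 + C) + K * (1 + C))) => // x B A a [BN Bx] AN dAB AB.
have [B0|Bn0] := eqVneq B fset0.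
  move: AB; rewrite B0 cardfs0 leqn0 cardfs_eq0 => /eqP ->.
  by rewrite proj_fset0 big_seq_fset0 !subr0 ler_peMl.
have [i0 i0B i0min] := fset_min_exists (fun i => `|coef N e i x|) Bn0.
pose t := `|coef N e i0 x|.
pose y := x - \sum_(i <- A) a i *: e i; rewrite -/y.
have yE n : coef N e n y = coef N e n x - (if n \in A then a n else 0).
  by rewrite coefB // coef_sum.
(* [A1] has to join [B] to make a greedy set of [y]; on [A2] the coefficients of [y] are at most
   [t]. *)
pose A1 := [fset i in A | t < `|coef N e i y|]%fset.
pose A2 := [fset i in A | `|coef N e i y| <= t]%fset.
pose G := (B `|` A1)%fset.
have dA12 : [disjoint A1 & A2]%fset.
  by apply/fdisjointP => i; rewrite !inE ltNge => /andP[-> /negbTE ->].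
have dBA1 : [disjoint B & A1]%fset.
  rewrite fdisjoint_sym; apply/fdisjointP => i; rewrite !inE => /andP[iA _].
  exact: (fdisjointP dAB).
have AE : A = (A1 `|` A2)%fset.
  apply/fsetP => i; rewrite !inE -andb_orr.
  by have [|] := ltP t; rewrite andbT.
have A1A i : i \in A1 -> i \in A by rewrite AE inE => ->.
have A2A i : i \in A2 -> i \in A by rewrite AE inE orbC => ->.
have notA i : i \in B -> i \notin A.
  by apply: fdisjointP; rewrite fdisjoint_sym.
have yB i : i \in B -> coef N e i y = coef N e i x.
  by move=> /notA/negbTE iA; rewrite yE iA subr0.
have GN i : i \in G -> idx N i by rewrite inE => /orP[/BN|/A1A/AN].
have tG i : i \in G -> t <= `|coef N e i y|.
  rewrite inE => /orP[iB|]; first by rewrite yB // i0min.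
  by rewrite !inE => /andP[_ /ltW].
have yG : is_greedy_set N e y G.
  split=> // i j /tG ti jN; rewrite inE negb_or => /andP[jB jA1].
  apply: le_trans ti; have [jA|jA] := boolP (j \in A).
    by move: jA1; rewrite !inE jA /= -leNgt.
  by rewrite yE (negbTE jA) subr0; apply: Bx.
have AG : (#|` A| <= #|` G|)%N.
  exact: leq_trans AB (fsubset_leq_card (fsubsetUl _ _)).
have A2G : (#|` A2| <= #|` G|)%N.
  by apply: leq_trans AG; apply: fsubset_leq_card; apply/fsubsetP.
(* All coefficients of [P_G y] are at least [t], so it dominates any sum over at most [#|G|] indices
   with coefficients at most [t]; it is itself bounded by [(1 + C) * |y|]. *)
have KG E : (forall i, i \in E -> idx N i) -> (#|` E| <= #|` G|)%N ->
    forall z, (forall i, i \in E -> `|coef N e i z| <= t) ->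
    `|Defs.proj N e E z| <= K * (1 + C) * `|y|.
  move=> EN EG z zt; rewrite -mulrA.
  apply: le_trans (boundK E G _ _ t EN GN EG (normr_ge0 _) zt tG) _.
  by rewrite ler_wpM2l // greedy_proj_bound.
(* Write [x] as [y] plus the sum of the [a i *: e i]. That sum is [P_A x - P_A y], and its part
   [P_A1 y] cancels against the one in [P_G y = P_B x + P_A1 y]. *)
have -> : x - Defs.proj N e B x =
    (y - Defs.proj N e G y) + (Defs.proj N e A x - Defs.proj N e A2 y).
  have yA : Defs.proj N e A x = \sum_(i <- A) a i *: e i + Defs.proj N e A y.
    rewrite /Defs.proj -big_split big_seq [RHS]big_seq /=; apply: eq_bigr => i iA.
    by rewrite -scalerDl yE iA subrKC.
  have yA12 : Defs.proj N e A y = Defs.proj N e A1 y + Defs.proj N e A2 y.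
    by rewrite {1}AE /Defs.proj sum_fsetU.
  have yBA1 : Defs.proj N e G y = Defs.proj N e B x + Defs.proj N e A1 y.
    by rewrite [Defs.proj N e B x](esym (eq_proj_sum yB)) /Defs.proj sum_fsetU.
  rewrite yA yA12 yBA1 [in RHS](addrA (\sum_(i <- A) _)) addrK opprD.
  by rewrite [X in _ = _ + X]addrC !addrA subrK addrAC subrK.
rewrite mulrDl mulrDl; apply: le_trans (ler_normD _ _) _; apply: lerD.
  exact: quasi_greedy_bound.
apply: le_trans (ler_normB _ _) _; apply: lerD; apply: KG => // i.
- by move=> iA; apply: Bx => //; [exact: AN | exact: (fdisjointP dAB)].
- by move=> /A2A/AN.
- by rewrite !inE => /andP[].
Qed.

End SeparatedToLargest.
End GreedyBounds.

(** * Extreme indices of greedy sets; lower bound for the norms *)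

Lemma bigminn_le (z j : nat) (s : seq nat) :
  j \in s -> (\big[minn/z]_(i <- s) i <= j)%N.
Proof.
elim: s => // i s IH; rewrite inE big_cons => /predU1P[->|/IH js].
  exact: geq_minl.
exact: leq_trans (geq_minr _ _) js.
Qed.

Lemma mem_greedy_set0 (rho : nat -> nat) (m : nat) :
  (0 < m)%N -> rho 0%N \in greedy_set rho m.
Proof. by move=> m0; apply/imfsetP; exists 0%N; rewrite //= mem_iota. Qed.

Lemma ltn_alpha (rho : nat -> nat) (m i : nat) : (0 < m)%N ->
  (i < alpha rho m)%N <-> (forall j, j \in greedy_set rho m -> (i < j)%N).
Proof.
move=> m0; split=> [im j jm|im]; first exact: leq_trans im (bigminn_le _ jm).
rewrite /alpha big_seq; elim/big_ind: _ => [|p q ip iq|j]; last exact: im.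
  exact/im/mem_greedy_set0.
by rewrite leq_min ip.
Qed.

Lemma beta_ltn (rho : nat -> nat) (m i : nat) : (0 < m)%N ->
  (beta rho m < i)%N <-> (forall j, j \in greedy_set rho m -> (j < i)%N).
Proof.
move=> m0; split=> [mi j jm|im].
  exact: leq_ltn_trans (leq_bigmax_seq j jm isT) mi.
rewrite /beta big_seq; elim/big_ind: _ => [|p q pi qi|j]; last exact: im.
  (* The starting value 0 of the maximum is below [i] because [rho 0] is. *)
  exact: leq_ltn_trans (im _ (mem_greedy_set0 _ m0)).
by rewrite gtn_max pi.
Qed.

Lemma seminormalized_lower_bound (R : realType) (X : completeNormedModType R)
    (N : option nat) (e : nat -> X) : seminormalized N e ->
  exists2 c : R, 0 < c & forall n, idx N n -> c <= `|e n|.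
Proof.
move=> [inf_gt0 _].
have infP n : idx N n ->
    (ereal_inf [set `|e n|%:E | n in [set n | idx N n]] <= `|e n|%:E)%E.
  by move=> nN; apply: ereal_inf_lbound; exists n.
move: inf_gt0 infP; case: ereal_inf => [r||] //= r0 rP.
  by exists r => // n /rP; rewrite lee_fin.
(* An infinite infimum means that there are no indices, and any positive constant will do. *)
by exists 1 => // n /rP; rewrite leye_eq.
Qed.

(** * Both assertions against the separated estimate *)

Section Equivalence.
Context {R : realType} {X : completeNormedModType R}.
Variables (N : option nat) (e : nat -> X).
Hypothesis e_basis : schauder_basis N e.
Variable c : R.
Hypothesis c_gt0 : 0 < c.
Hypothesis c_le : forall n, idx N n -> c <= `|e n|.
Implicit Types (x : X) (A B : {fset nat}).

(** Nonempty greedy sets come from orderings. The empty one corresponds to the inadmissible length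
    0; then [A] is empty too, and a constant at least 1 suffices, hence the maximum with 1. *)
Lemma separated_greedy_bound_ordering (C : R) :
  (forall x rho m A, greedy_ordering N e x rho -> admissible N m ->
     (forall i, i \in A -> idx N i) -> separated A (greedy_set rho m) ->
     (#|` A| <= m)%N ->
     `|x - greedy_sum N e rho m x| <= C * `|x - Defs.proj N e A x|) ->
  exists2 C', 1 <= C' & separated_greedy_bound N e C'.
Proof.
move=> boundC; exists (Num.max 1 C) => [|x B A xB AN sAB AB].
  by rewrite le_max lexx.
have [B0|B0] := eqVneq B fset0.
  move: AB; rewrite B0 cardfs0 leqn0 cardfs_eq0 => /eqP ->.
  by rewrite proj_fset0 subr0 ler_peMl // le_max lexx.
have [rho xrho rhoB] := greedy_ordering_exists e_basis c_gt0 c_le xB.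
have BN : admissible N #|` B| by apply: admissible_card => //; case: xB.
have := boundC x rho _ A xrho BN AN; rewrite /greedy_sum rhoB => /(_ sAB AB).
by move/le_trans; apply; rewrite ler_wpM2r // le_max lexx orbT.
Qed.

Definition proj_errors (x : X) (m : nat) : set R :=
  [set `|x - Defs.proj N e A x| | A in
    [set A : {fset nat} | (forall i, i \in A -> idx N i) /\ (#|` A| <= m)%N]].

Lemma inf_proj_errors_ge0 x m : 0 <= inf (proj_errors x m).
Proof.
apply: lb_le_inf => [|_ [A _ <-] //].
by exists `|x - Defs.proj N e fset0 x|; exists fset0.
Qed.

Lemma inf_proj_errors_le x m A : (forall i, i \in A -> idx N i) ->
  (#|` A| <= m)%N -> inf (proj_errors x m) <= `|x - Defs.proj N e A x|.
Proof.
move=> AN Am; apply: ge_inf; last by exists A.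
by exists 0 => _ [A' _ <-].
Qed.

Lemma almost_greedy_separated : almost_greedy N e ->
  exists2 C, 1 <= C & separated_greedy_bound N e C.
Proof.
(* The sign of [C] is not given, and passing from the infimum to a single [A] needs a nonnegative
   factor. *)
move=> [C boundC]; apply: (@separated_greedy_bound_ordering `|C|).
move=> x rho m A xrho mN AN _ Am; apply: le_trans (boundC x rho m xrho mN) _.
apply: le_trans (_ : `|C| * inf (proj_errors x m) <= _).
  by rewrite ler_wpM2r ?ler_norm // inf_proj_errors_ge0.
by rewrite ler_wpM2l // inf_proj_errors_le.
Qed.

Definition outer_greedy_bound (C : R) : Prop :=
  forall (x : X) (rho : nat -> nat) (m : nat) (A : {fset nat}) (a : nat -> R),
    greedy_ordering N e x rho -> admissible N m ->
    (forall i, i \in A ->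
       idx N i /\ ((i < alpha rho m)%N \/ (beta rho m < i)%N)) ->
    (#|` A| <= m)%N ->
    `|x - greedy_sum N e rho m x| <= C * `|x - \sum_(i <- A) a i *: e i|.

(** With the coefficients of [x] as the [a i], the sum over [A] becomes [P_A x]. *)
Lemma outer_greedy_separated C : outer_greedy_bound C ->
  exists2 C', 1 <= C' & separated_greedy_bound N e C'.
Proof.
move=> boundC; apply: (@separated_greedy_bound_ordering C).
move=> x rho m A xrho mN AN sA Am; apply: boundC => // i iA.
have m0 : (0 < m)%N by case/andP: mN.
split; first exact: AN.
case: sA => sA; [left; apply/ltn_alpha | right; apply/beta_ltn] => // j jm;
  exact: sA.
Qed.

Lemma separated_outer_greedy C : 1 <= C -> separated_greedy_bound N e C ->
  exists C', outer_greedy_bound C'.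
Proof.
move=> C1 sepC.
have [C' _ boundC'] := disjoint_greedy_bound e_basis c_gt0 c_le C1 sepC.
exists C' => x rho m A a xrho mN AN Am.
have [xB cardB] := greedy_setP xrho mN.
have m0 : (0 < m)%N by case/andP: mN.
apply: boundC' => // [i /AN[] //||]; last by rewrite cardB.
apply/fdisjointP => i /AN[_ iab]; apply/negP => im.
by case: iab => [/(ltn_alpha _ _ m0)|/(beta_ltn _ _ m0)] /(_ _ im); rewrite ltnn.
Qed.

Lemma separated_almost_greedy C : 1 <= C -> separated_greedy_bound N e C ->
  almost_greedy N e.
Proof.
move=> C1 sepC.
have [C' C'1 boundC'] := disjoint_greedy_bound e_basis c_gt0 c_le C1 sepC.
have C'0 : 0 < C' by apply: lt_le_trans C'1.
(* Dividing by the positive [C'] reduces the claim to a lower bound for every member of the set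
   under the infimum. *)
exists C' => x rho m xrho mN; rewrite mulrC -ler_pdivrMr //.
apply: lb_le_inf => [|_ [A [AN Am] <-]].
  by exists `|x - Defs.proj N e fset0 x|; exists fset0.
rewrite ler_pdivrMr // mulrC /greedy_sum.
have [[BN Bx] cardB] := greedy_setP xrho mN.
set B := greedy_set rho m in BN Bx cardB *.
pose I := (A `&` B)%fset; pose D := (B `\` A)%fset; pose E := (A `\` B)%fset.
have IN i : i \in I -> idx N i by rewrite inE => /andP[/AN].
have EN i : i \in E -> idx N i by rewrite inE => /andP[_ /AN].
have DN i : i \in D -> idx N i by rewrite inE => /andP[_ /BN].
pose u := x - Defs.proj N e I x.
have uE n : coef N e n u = if n \in I then 0 else coef N e n x.
  by rewrite coefB // coef_proj //; case: ifP; rewrite ?subrr ?subr0.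
have projU F F' : [disjoint F & F']%fset -> Defs.proj N e (F `|` F')%fset x =
    Defs.proj N e F x + Defs.proj N e F' x.
  exact: sum_fsetU.
have uF F : [disjoint I & F]%fset -> Defs.proj N e F u = Defs.proj N e F x.
  rewrite fdisjoint_sym => dF; apply: eq_proj_sum => i iF.
  by rewrite uE (negbTE (fdisjointP dF i iF)).
have dID : [disjoint I & D]%fset.
  by apply/fdisjointP => i; rewrite !inE => /andP[->].
have dIE : [disjoint I & E]%fset.
  by apply/fdisjointP => i; rewrite !inE => /andP[_ ->].
have -> : x - Defs.proj N e B x = u - Defs.proj N e D u.
  rewrite uF // /u -addrA -opprD -projU //; congr (_ - Defs.proj N e _ _).
  by apply/fsetP => i; rewrite !inE; case: (i \in A); rewrite ?orbF.
have -> : x - Defs.proj N e A x = u - Defs.proj N e E u.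
  rewrite uF // /u -addrA -opprD -projU //; congr (_ - Defs.proj N e _ _).
  by apply/fsetP => i; rewrite !inE; case: (i \in B); rewrite /= ?andbT ?andbF ?orbF.
apply: boundC' => //.
(* The coefficients of [u] vanish on [I] and agree with those of [x] elsewhere; an index outside
   both [D] and [I] is outside [B]. *)
- split=> // i j; rewrite inE => /andP[iA iB] jN jD.
  rewrite !uE !inE (negbTE iA) /=; case: ifPn => [|jI]; first by rewrite normr0.
  apply: Bx => //; apply: contra jD => jB; rewrite inE jB andbT.
  by apply: contra jI => ->.
- by apply/fdisjointP => i; rewrite !inE => /andP[/negbTE ->]; rewrite andbF.
(* Adding [#|I|] to both sides turns [#|E| <= #|D|] into [#|A| <= #|B|]. *)
- rewrite -(leq_add2l #|` I|) /E cardfsID /D /I fsetIC cardfsID cardB.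
  exact: Am.
Qed.

End Equivalence.

Theorem theorem2p12 (R : realType) (X : completeNormedModType R)
    (N : option nat) (e : nat -> X)
    (e_basis : schauder_basis N e) (e_seminormalized : seminormalized N e) :
  almost_greedy N e <->
  exists C : R, forall (x : X) (rho : nat -> nat) (m : nat) (A : {fset nat})
      (a : nat -> R),
    greedy_ordering N e x rho -> admissible N m ->
    (forall i, i \in A ->
       idx N i /\ ((i < alpha rho m)%N \/ (beta rho m < i)%N)) ->
    (#|` A| <= m)%N ->
    `|x - greedy_sum N e rho m x| <= C * `|x - \sum_(i <- A) a i *: e i|.
Proof.
have [c c_gt0 c_le] := seminormalized_lower_bound e_seminormalized.
split=> [/(almost_greedy_separated e_basis c_gt0 c_le)[C C1]|[C]].
  exact: (separated_outer_greedy e_basis c_gt0 c_le C1).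
move/(outer_greedy_separated e_basis c_gt0 c_le) => [C' C'1].
exact: (separated_almost_greedy e_basis c_gt0 c_le C'1).
Qed.
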